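(* Let $G$ be a simple graph of order $n$ with $m$ edges, and let $c_k$ be the number of closed walks of length $k$ in $G$. If either (a) $G$ has no triangle, or (b) $G$ has no square and $m\ge 9$, then $$4c_6+34m^3\ge 21\,m\,c_4.$$ Moreover, equality is realized in case (a) by any complete bipartite graph and in case (b) by the star graph $S_n=K_{1,n-1}$.
   Context: If $\lambda_1,\dots,\lambda_n$ are the adjacency eigenvalues of $G$, then $c_k=\lambda_1^k+\cdots+\lambda_n^k$. ''No triangle'' (resp. ''no square'') means that $G$ contains no $3$-cycle (resp. no $4$-cycle) as a (not necessarily induced) subgraph. *)

(* Defs.v *)
From mathcomp Require Import all_boot.

Set Implicit Arguments.
Unset Strict Implicit.
Unset Printing Implicit Defensive.

(* A simple graph is a symmetric irreflexive adjacency relation e on a finType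
   of vertices; its order is #|T|. *)

(* Edges are unordered pairs, so each is counted once. *)
Definition edges (T : finType) (e : rel T) : {set {set T}} :=
  [set E : {set T} | [exists x, exists y, e x y && (E == [set x; y])]].

(* A closed walk of length k is a walk v_0, v_1, ..., v_k with v_k = v_0,
   encoded as w = (v_0, (v_1, ..., v_k)); vertices and edges may repeat, and
   closed walks differing in start or direction count as distinct. *)
Definition closed_walks (T : finType) (e : rel T) (k : nat) :
    {set T * k.-tuple T} :=
  [set w : T * k.-tuple T | path e w.1 w.2 && (last w.1 w.2 == w.1)].

(* ucycleb requires the k vertices to be distinct; nothing is asked of the
   other pairs, so the subgraph need not be induced. Meaningful for k >= 3. *)
Definition has_cycle (T : finType) (e : rel T) (k : nat) : bool :=
  [exists c : k.-tuple T, ucycleb e c].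

Definition triangle_free (T : finType) (e : rel T) : bool := ~~ has_cycle e 3.

Definition square_free (T : finType) (e : rel T) : bool := ~~ has_cycle e 4.

(* e is (isomorphic to) K_{p,q}, with parts A and ~: A. An empty part is
   allowed, so that K_{1,0} is the star of order 1. *)
Definition complete_bipartite (T : finType) (e : rel T) (p q : nat) : Prop :=
  exists A : {set T},
    [/\ #|A| = p, #|~: A| = q &
        forall x y, e x y = ((x \in A) != (y \in A))].

Definition star (T : finType) (e : rel T) (n : nat) : Prop :=
  0 < n /\ complete_bipartite e 1 n.-1.

(* Main.v *)
Require Import Defs.
From mathcomp Require Import all_boot zify.

Set Implicit Arguments.
Unset Strict Implicit.
Unset Printing Implicit Defensive.

(** Write A for the adjacency matrix, so that c_k is the trace of A^k and
c_2 = 2m. Then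
<<
  4 c_6 + 34 m^3 - 21 m c_4
    = 4 (c_6 - 2 m c_4 + m^2 c_2) + 13 m (2 m^2 - c_4),
>>
and both brackets are nonnegative. The first is the sum of the squares of the
entries of A^3 - m A ([closed_walks6_ge]); this holds in every graph. The
second is where forbidden cycles enter ([closed_walks4_le]): a closed walk
(a, b, c, d) is determined by the pair of oriented edges (a, b), (c, d), and
exchanging c and d reverses the second edge. If both a pair and its exchange
came from closed walks, then a, b, c, d would be pairwise adjacent. So in a
graph without K_4 the closed walks fill at most half of the (2m)^2 pairs, that
is c_4 <= 2 m^2. Since K_4 contains both a triangle and a square, excluding
either cycle is enough.

In K_{p,q} one has A^3 = p q A = m A, hence c_4 = m c_2 = 2 m^2 and
c_6 = m^2 c_2 = 2 m^3: both brackets vanish. Stars are the case p = 1.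

The powers of A are represented by the numbers of walks between two vertices,
so that all sums are sums of natural numbers. *)

(** * Walks between two vertices *)

(** The entry of index (x, y) of the k-th power of the adjacency matrix. *)
Fixpoint walks (T : finType) (e : rel T) (k : nat) (x y : T) : nat :=
  if k is j.+1 then \sum_z e x z * walks e j z y else x == y.

Section Walks.

Variables (T : finType) (e : rel T).

Lemma walksE k x y :
  \sum_(t : k.-tuple T) (path e x t && (last x t == y)) = walks e k x y.
Proof.
elim: k x => [|k IHk] x.
  rewrite (eq_bigr (fun=> nat_of_bool (x == y))); last by move=> [[]].
  by rewrite sum_nat_const card_tuple expn0 mul1n.
pose cons_pair (p : T * k.-tuple T) := [tuple of p.1 :: p.2].
rewrite (reindex cons_pair) /=; last first.
  exists (fun t => (thead t, [tuple of behead t])) => [[z t]|t] _.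
    by rewrite /cons_pair theadE; congr (_, _); apply: val_inj.
  by rewrite [RHS]tuple_eta.
rewrite -(pair_bigA _ (fun z (t : k.-tuple T) =>
  nat_of_bool (e x z && path e z t && (last z t == y)))) /=.
apply: eq_bigr => z _; rewrite -IHk big_distrr /=.
by apply: eq_bigr => t _; rewrite -andbA mulnb.
Qed.

Lemma card_closed_walks k : #|closed_walks e k| = \sum_x walks e k x x.
Proof.
rewrite -sum1_card big_mkcond /=.
rewrite (eq_bigr (fun w : T * k.-tuple T =>
  nat_of_bool (path e w.1 w.2 && (last w.1 w.2 == w.1)))); last first.
  by move=> w _; rewrite inE; case: ifP.
rewrite -(pair_bigA _ (fun x (t : k.-tuple T) =>
  nat_of_bool (path e x t && (last x t == x)))) /=.
by apply: eq_bigr => x _; apply: walksE.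
Qed.

Lemma walksD j k x y :
  walks e (j + k) x y = \sum_z walks e j x z * walks e k z y.
Proof.
elim: j x => [|j IHj] x /=.
  rewrite add0n (bigD1 x) //= eqxx mul1n big1 ?addn0 // => z zx.
  by rewrite eq_sym (negPf zx).
under eq_bigr do rewrite IHj big_distrr /=.
rewrite exchange_big; apply: eq_bigr => z _; rewrite big_distrl.
by apply: eq_bigr => i _; rewrite mulnA.
Qed.

Lemma walks1 x y : walks e 1 x y = e x y.
Proof.
rewrite /= (bigD1 y) //= eqxx muln1 big1 ?addn0 // => z zy.
by rewrite (negPf zy) muln0.
Qed.

Hypothesis e_sym : symmetric e.

Lemma walks_sym k x y : walks e k x y = walks e k y x.
Proof.
elim: k x y => [|k IHk] x y; first by rewrite /= eq_sym.
rewrite -[in RHS]addn1 walksD; apply: eq_bigr => z _.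
by rewrite walks1 -/(walks e k z y) e_sym IHk mulnC.
Qed.

(** The trace of the product of two powers of a symmetric matrix is the
entrywise scalar product of these powers. *)
Lemma card_closed_walksD j k :
  #|closed_walks e (j + k)| = \sum_x \sum_y walks e j x y * walks e k x y.
Proof.
rewrite card_closed_walks; apply: eq_bigr => x _; rewrite walksD.
by apply: eq_bigr => y _; rewrite (walks_sym k).
Qed.

(** With w3 and w1 the entries of A^3 and A, this is the sum over all entries
of 2 w3 (m w1) <= w3^2 + (m w1)^2. *)
Lemma closed_walks6_ge m :
  2 * m * #|closed_walks e 4| <=
    #|closed_walks e 6| + m ^ 2 * #|closed_walks e 2|.
Proof.
rewrite (card_closed_walksD 3 1) (card_closed_walksD 3 3).
rewrite (card_closed_walksD 1 1) !big_distrr -big_split /=.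
apply: leq_sum => x _; rewrite !big_distrr -big_split /=.
apply: leq_sum => y _.
rewrite !mulnn -[2 * m * _]mulnA [m * (_ * _)]mulnCA -expnMn.
by have [] := nat_Cauchy (walks e 3 x y) (m * walks e 1 x y).
Qed.

Hypothesis e_irr : irreflexive e.

(** * Short closed walks *)

(** Each edge, as an unordered pair, has two orientations. *)
Lemma sum_edges : \sum_x \sum_y (e x y : nat) = 2 * #|edges e|.
Proof.
rewrite pair_bigA /=.
rewrite (eq_bigr (fun p => if e p.1 p.2 then 1 else 0)); last first.
  by move=> p _; case: (e _ _).
rewrite -big_mkcond /=.
rewrite (partition_big (fun p => [set p.1; p.2]) (mem (edges e))) /=; last first.
  move=> [x y] /= exy; rewrite inE; apply/existsP; exists x.
  by apply/existsP; exists y; rewrite exy eqxx.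
rewrite mulnC -sum_nat_const; apply: eq_bigr => E.
rewrite inE => /existsP[a /existsP[b /andP[eab /eqP->]]].
have ab : a != b by apply: contraTneq eab => ->; rewrite e_irr.
rewrite sum1_card -(_ : #|[set (a, b); (b, a)]| = 2); last first.
  by rewrite cards2 xpair_eqE (negPf ab).
apply: eq_card => -[x y]; rewrite !inE /= unfold_in /= !xpair_eqE.
apply/andP/orP => [[exy /eqP xyab]|[] /andP[/eqP-> /eqP->]]; last 2 first.
- by rewrite eab.
- by rewrite e_sym eab setUC.
have xy : x != y by apply: contraTneq exy => ->; rewrite e_irr.
have := set21 x y; have := set22 x y; rewrite xyab !inE.
move=> /pred2P[] yE /pred2P[] xE; subst; rewrite ?eqxx in xy *; auto.
Qed.

Lemma closed_walks2 : #|closed_walks e 2| = 2 * #|edges e|.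
Proof.
rewrite (card_closed_walksD 1 1) -sum_edges; apply: eq_bigr => x _.
by apply: eq_bigr => y _; rewrite !walks1; case: (e x y).
Qed.

Lemma closed_walks4E :
  #|closed_walks e 4| =
    \sum_a \sum_b \sum_c \sum_d e a b * e b c * e c d * e d a.
Proof.
rewrite card_closed_walks; apply: eq_bigr => a _ /=.
apply: eq_bigr => b _; rewrite big_distrr; apply: eq_bigr => c _ /=.
rewrite !big_distrr; apply: eq_bigr => d _.
by rewrite -/(walks e 1 d a) walks1 /= !mulnA.
Qed.

(** The hypothesis says that there is no K_4: its first four edges form the walk
(a, b, c, d), and the last two complete the exchanged walk (a, b, d, c). *)
Lemma closed_walks4_le :
    (forall a b c d,
       ~~ [&& e a b, e b c, e c d, e d a, e b d & e c a]) ->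
  #|closed_walks e 4| <= 2 * #|edges e| ^ 2.
Proof.
move=> K4free.
have swapE : #|closed_walks e 4| =
    \sum_a \sum_b \sum_c \sum_d e a b * e b d * e d c * e c a.
  rewrite closed_walks4E; apply: eq_bigr => a _; apply: eq_bigr => b _.
  by rewrite exchange_big.
have dartsE : (2 * #|edges e|) ^ 2 =
    \sum_a \sum_b \sum_c \sum_d e a b * e c d.
  rewrite -sum_edges expnS expn1 big_distrl; apply: eq_bigr => a _.
  rewrite big_distrl; apply: eq_bigr => b _.
  by rewrite big_distrr; apply: eq_bigr => c _; rewrite big_distrr.
suff: #|closed_walks e 4| + #|closed_walks e 4| <= (2 * #|edges e|) ^ 2.
  by rewrite expnMn; lia.
rewrite {1}closed_walks4E swapE dartsE.
rewrite -big_split; apply: leq_sum => a _.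
rewrite -big_split; apply: leq_sum => b _.
rewrite -big_split; apply: leq_sum => c _.
rewrite -big_split; apply: leq_sum => d _ /=.
(* A pointwise inequality: the factor e a b * e c d is common to the three
   terms, and when it is 1, at most one of the two remaining products is. *)
move: (K4free a b c d); rewrite [e d c]e_sym.
by do 6![case: (e _ _)].
Qed.

Lemma has_cycle3 a b c : e a b -> e b c -> e c a -> has_cycle e 3.
Proof.
move=> ab bc ca; apply/existsP; exists [tuple a; b; c].
rewrite /ucycleb /= !inE ab bc ca !negb_or /= !andbT.
have neq x y : e x y -> x != y by apply: contraTneq => ->; rewrite e_irr.
by rewrite (neq _ _ ab) (neq _ _ bc) eq_sym (neq _ _ ca).
Qed.

Lemma has_cycle4 a b c d :
  e a b -> e b c -> e c d -> e d a -> a != c -> b != d -> has_cycle e 4.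
Proof.
move=> ab bc cd da ac bd; apply/existsP; exists [tuple a; b; c; d].
rewrite /ucycleb /= !inE ab bc cd da !negb_or /= !andbT.
have neq x y : e x y -> x != y by apply: contraTneq => ->; rewrite e_irr.
by rewrite ac bd (neq _ _ ab) (neq _ _ bc) (neq _ _ cd) eq_sym (neq _ _ da).
Qed.

(** Both cycles needed here are subgraphs of K_4: the triangle (a, b, c), and
the square (a, b, c, d), whose diagonals provide the distinctness of opposite
vertices. *)
Lemma no_triangle_or_square_K4_free :
    triangle_free e || square_free e ->
  forall a b c d, ~~ [&& e a b, e b c, e c d, e d a, e b d & e c a].
Proof.
move=> cycle_free a b c d; apply/negP => /and5P[ab bc cd da /andP[bd ca]].
have neq x y : e x y -> x != y by apply: contraTneq => ->; rewrite e_irr.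
case/orP: cycle_free => /negP[]; first exact: has_cycle3 ab bc ca.
by apply: (has_cycle4 ab bc cd da); rewrite 1?eq_sym neq // e_sym.
Qed.

End Walks.

(** * Complete bipartite graphs *)

Section CompleteBipartite.

Variables (T : finType) (e : rel T) (A : {set T}).
Hypothesis eE : forall x y, e x y = ((x \in A) != (y \in A)).

Lemma complete_bipartite_degree x :
  \sum_y (e x y : nat) = if x \in A then #|~: A| else #|A|.
Proof.
case: ifP => xA; rewrite -sum1_card [RHS]big_mkcond; apply: eq_bigr => y _.
  by rewrite eE xA inE; case: (y \in A).
by rewrite eE xA; case: (y \in A).
Qed.

(** In a walk (x, z, u, y) the middle edge exists as soon as x and y are
adjacent, z is adjacent to x and u is adjacent to y, since z and u then lie in
different parts; and a walk of length 3 joins only adjacent vertices. So the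
number of walks is the product of the degrees of x and y, which are the sizes
of the two parts. *)
Lemma complete_bipartite_walks3 x y :
  walks e 3 x y = #|A| * #|~: A| * walks e 1 x y.
Proof.
have -> : walks e 3 x y = \sum_z \sum_u e x y * (e x z * e u y).
  apply: eq_bigr => z _; rewrite -/(walks e 2 z y) (walksD e 1 1) big_distrr.
  apply: eq_bigr => u _ /=; rewrite -!/(walks e 1 _ _) !walks1 !eE.
  by do 4![case: (_ \in A)].
rewrite walks1 (eq_bigr (fun z => e x y * (e x z * \sum_u e y u))); last first.
  move=> z _; rewrite -!big_distrr; congr (_ * (_ * _)).
  by apply: eq_bigr => u _; rewrite !eE eq_sym.
rewrite -big_distrr -big_distrl /= !complete_bipartite_degree eE.
case: (x \in A); case: (y \in A); rewrite ?muln0 //= ?mul1n ?muln1 //.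
by rewrite mulnC.
Qed.

Lemma complete_bipartite_sum_edges :
  \sum_x \sum_y (e x y : nat) = 2 * (#|A| * #|~: A|).
Proof.
under eq_bigr do rewrite complete_bipartite_degree.
rewrite (bigID (mem A)) /= (eq_bigr (fun=> #|~: A|)); last by move=> x ->.
rewrite sum_nat_const [X in _ + X](eq_bigr (fun=> #|A|)); last first.
  by move=> x /negPf->.
rewrite (eq_bigl [in ~: A]); last by move=> x; rewrite /= in_setC.
by rewrite sum_nat_const [#|~: A| * _]mulnC addnn mul2n.
Qed.

Lemma complete_bipartite_triangle_free : triangle_free e.
Proof.
apply/existsP => -[[[|a [|b [|c []]]] //= _]] /andP[/=].
by rewrite !eE; do 3![case: (_ \in A)].
Qed.

(** Opposite vertices of a square lie in the same part, so that each part
contains two of its vertices. *)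
Lemma star_square_free : #|A| <= 1 -> square_free e.
Proof.
move=> /card_le1_eqP A1.
apply/existsP => -[[[|a [|b [|c [|d []]]]] //= _]] /andP[/=].
rewrite !eE => bip /and3P[]; rewrite !inE !negb_or => /and3P[_ ac _].
move=> /andP[_ bd] _.
have [aA | aA] := boolP (a \in A).
  have cA : c \in A by move: bip; rewrite aA; do 3![case: (_ \in A)].
  by rewrite (A1 a c) // eqxx in ac.
have [bA dA] : b \in A /\ d \in A.
  by move: bip; rewrite (negPf aA); do 3![case: (_ \in A)].
by rewrite (A1 b d) // eqxx in bd.
Qed.

End CompleteBipartite.

(** The scalar products of [card_closed_walksD] become multiples of c_2 = 2m
when A^3 is replaced by m A. *)
Lemma complete_bipartite_closed_walks (T : finType) (e : rel T) (m p q : nat) :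
    symmetric e -> irreflexive e -> #|edges e| = m ->
    complete_bipartite e p q ->
  [/\ m = p * q, #|closed_walks e 4| = 2 * m ^ 2
    & #|closed_walks e 6| = 2 * m ^ 3].
Proof.
move=> e_sym e_irr size_m [A [Ap Aq eE]].
have mE : m = p * q.
  have := complete_bipartite_sum_edges eE.
  by rewrite sum_edges // size_m Ap Aq; lia.
have w3E x y : walks e 3 x y = m * walks e 1 x y.
  by rewrite (complete_bipartite_walks3 eE) Ap Aq mE.
have w1w1 : \sum_x \sum_y walks e 1 x y * walks e 1 x y = 2 * m.
  by rewrite -size_m -(closed_walks2 e_sym e_irr) (card_closed_walksD e_sym 1 1).
split=> //.
  rewrite (card_closed_walksD e_sym 3 1) expnS expn1 mulnCA -w1w1.
  rewrite big_distrr; apply: eq_bigr => x _; rewrite big_distrr.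
  by apply: eq_bigr => y _; rewrite w3E -mulnA.
rewrite (card_closed_walksD e_sym 3 3) expnSr mulnCA -w1w1.
rewrite big_distrr; apply: eq_bigr => x _; rewrite big_distrr.
by apply: eq_bigr => y _; rewrite !w3E mulnACA.
Qed.

(** * The inequality and its equality cases *)

Theorem corollary4p8 (T : finType) (e : rel T) (n m : nat) (c : nat -> nat)
    (e_sym : symmetric e) (e_irr : irreflexive e)
    (order_n : #|T| = n) (size_m : #|edges e| = m)
    (walks_c : forall k, c k = #|closed_walks e k|) :
  [/\ (* the inequality *)
      triangle_free e \/ (square_free e /\ 9 <= m) ->
      4 * c 6 + 34 * m ^ 3 >= 21 * m * c 4,
      (* equality in case (a) *)
      forall p q, complete_bipartite e p q ->
      triangle_free e /\ 4 * c 6 + 34 * m ^ 3 = 21 * m * c 4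
    & (* equality in case (b) *)
      star e n ->
      [/\ square_free e, 10 <= n -> 9 <= m
        & 4 * c 6 + 34 * m ^ 3 = 21 * m * c 4]].
Proof.
have ineq : triangle_free e \/ (square_free e /\ 9 <= m) ->
    4 * c 6 + 34 * m ^ 3 >= 21 * m * c 4.
  move=> cycle_free.
  have c4_le : c 4 <= 2 * m ^ 2.
    rewrite walks_c -size_m; apply: closed_walks4_le => //.
    apply: no_triangle_or_square_K4_free => //.
    by apply/orP; case: cycle_free => [|[]]; [left | right].
  (* 4 times the first bracket plus 13 m times the second. *)
  have := closed_walks6_ge e_sym m.
  rewrite (closed_walks2 e_sym e_irr) size_m -!walks_c.
  by rewrite !expnS expn0 muln1 in c4_le *; nia.
have equality p q : complete_bipartite e p q ->
    4 * c 6 + 34 * m ^ 3 = 21 * m * c 4.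
  move=> bip; have [_ c4 c6] := complete_bipartite_closed_walks e_sym e_irr size_m bip.
  by rewrite !walks_c c4 c6 !expnS expn0; lia.
split=> // [p q bip | [n_gt0 bip]].
  split; last exact: equality bip.
  by case: bip => A [_ _ /complete_bipartite_triangle_free].
have [mE _ _] := complete_bipartite_closed_walks e_sym e_irr size_m bip.
split; last exact: equality bip.
  by case: bip => A [A1 _ eE]; apply: (star_square_free eE); rewrite A1.
by rewrite mE; lia.
Qed.
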